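(* In the setting described in the context, consider the problem $$\min_{z,r,t,x}\ c^\top x$$ over $z\in\{0,1\}^N$, $t\ge0$, $r\in\mathbb R^N_{\ge0}$, $x\in\mathcal X$ subject to $\epsilon t\ge\theta\|b-A^\top x\|_*+\frac1N\sum_{i\in[N]}r^i$; $M^i(1-z^i)\ge t-r^i$ for $i\in[N]$; $\sum_{i\in[N]}z^i\le\lfloor\epsilon N\rfloor$; $(-A\xi^i_p-a_p)^\top x\ge q^i_p$ for $i\in[N],p\in[P]$; $(-A\xi^i_p-a_p)^\top x+(b^\top\xi^i_p+d_p)+(-b^\top\xi^i_p-d_p-q^i_p)z^i\ge t-r^i$ for $i\in[N],p\in[P]$. Call this the improved formulation. It is a valid reformulation of the distributionally robust chance-constrained program, in the following sense. Its optimal value is attained and equals $\min\{c^\top x: x\in\mathcal X_{\mathrm{DR}}(\mathcal S^c)\}$, and the $x$-component of any optimal solution of the improved formulation is an optimal solution of $\min\{c^\top x:x\in\mathcal X_{\mathrm{DR}}(\mathcal S^c)\}$. Moreover, if the $x$-component of an optimal solution of the improved formulation satisfies $b\ne A^\top x$ or ($d_p\ne a_p^\top x$ for all $p\in[P]$), then it is also an optimal solution of $\min\{c^\top x:x\in\mathcal X_{\mathrm{DR}}(\mathcal S^o)\}$.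
   Context: Notation: $[n]=\{1,\dots,n\}$. Data: $\mathcal X\subseteq\mathbb R^L$; $c\in\mathbb R^L$; positive integers $N,P,K_0$, $K=PK_0$; $A\in\mathbb R^{L\times K_0}$, $b\in\mathbb R^{K_0}$, $a_p\in\mathbb R^L$, $d_p\in\mathbb R$ for $p\in[P]$; risk tolerance $\epsilon\in(0,1)$; radius $\theta>0$. Vectors $\xi\in\mathbb R^K$ are written in blocks $\xi=(\xi_1,\dots,\xi_P)$ with $\xi_p\in\mathbb R^{K_0}$. Samples $\xi^1,\dots,\xi^N\in\mathbb R^K$ are fixed, with blocks $\xi^i_p$, and $\mathbb P_N$ is the empirical distribution (mass $1/N$ at each $\xi^i$). $\|\cdot\|$ is a norm on $\mathbb R^K$. For $v\in\mathbb R^{K_0}$, $\|v\|_*$ denotes the dual norm of the vector in $\mathbb R^K$ having $v$ in block $p$ and zeros elsewhere; this is assumed not to depend on $p$ (as for $\ell_q$-norms). Wasserstein distance: $d_W(\mathbb P,\mathbb P')=\inf_\Pi\{\mathbb E_{(\xi,\xi')\sim\Pi}\|\xi-\xi'\|:\Pi\text{ has marginals }\mathbb P,\mathbb P'\}$, and $\mathcal F_N(\theta)=\{\mathbb P: d_W(\mathbb P_N,\mathbb P)\le\theta\}$, a set of probability distributions on $\mathbb R^K$. Safety sets, for $x\in\mathcal X$: $\mathcal S^o(x)=\{\xi\in\mathbb R^K:(b-A^\top x)^\top\xi_p+d_p-a_p^\top x>0,\ p\in[P]\}$ (open), $\mathcal S^c(x)=\{\xi\in\mathbb R^K:(b-A^\top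 x)^\top\xi_p+d_p-a_p^\top x\ge0,\ p\in[P]\}$ (closed). For $\mathcal S\in\{\mathcal S^o,\mathcal S^c\}$, $\mathcal X_{\mathrm{DR}}(\mathcal S)=\{x\in\mathcal X:\sup_{\mathbb P\in\mathcal F_N(\theta)}\mathbb P[\xi\notin\mathcal S(x)]\le\epsilon\}$; the distributionally robust chance-constrained program is $\min\{c^\top x:x\in\mathcal X_{\mathrm{DR}}(\mathcal S)\}$. The constants $M^1,\dots,M^N>0$ are sufficiently large, meaning $M^i\ge|(-A\xi_p^i-a_p)^\top x+(b^\top\xi_p^i+d_p)|$ for all $x\in\mathcal X$, $p\in[P]$. The knapsack formulation is: minimize $c^\top x$ over $z\in\{0,1\}^N$, $t\ge0$, $r\in\mathbb R^N_{\ge0}$, $x\in\mathcal X$ subject to $\epsilon t\ge\theta\|b-A^\top x\|_*+\frac1N\sum_{i}r^i$; $M^i(1-z^i)\ge t-r^i$ ($i\in[N]$); $(-A\xi_p^i-a_p)^\top x+(b^\top\xi_p^i+d_p)+M^iz^i\ge t-r^i$ ($i\in[N],p\in[P]$); $\sum_iz^i\le\lfloor\epsilon N\rfloor$; $(-A\xi_p^i-a_p)^\top x+(b^\top\xi_p^i+d_p)+M^iz^i\ge0$ ($i\in[N],p\in[P]$). Quantiles: $\bar{\mathcal X}\subseteq\mathbb R^L$ is a set containing the $x$-component of at least one optimal solution of the knapsack formulation (assumed to exist). For $i,j\in[N]$, $p\in[P]$, $$\bar h^j(-A\xi^i_p-a_p)=\min\{(-A\xi^i_p-a_p)^\top x: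 x\in\bar{\mathcal X},\ (-A\xi^j_g-a_g)^\top x+(b^\top\xi^j_g+d_g)\ge0,\ g\in[P]\}$$ (read as an infimum in $[-\infty,+\infty]$, equal to $+\infty$ if infeasible). With $k=\lfloor\epsilon N\rfloor$, $q^i_p$ is the $(k+1)$-th largest value (with multiplicity) among $\bar h^1(-A\xi^i_p-a_p),\dots,\bar h^N(-A\xi^i_p-a_p)$. All $q^i_p$ are assumed to be finite. *)

(* Defs.v *)
From HB Require Import structures.
From mathcomp Require Import all_boot all_order all_algebra.
From mathcomp Require Import all_classical all_reals all_analysis.

Set Implicit Arguments.
Unset Strict Implicit.
Unset Printing Implicit Defensive.

Import Order.TTheory GRing.Theory Num.Theory.
Import numFieldNormedType.Exports.

Local Open Scope classical_set_scope.
Local Open Scope ring_scope.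

(* R^K with K = P * K0 is represented by K0 x P matrices, the p-th column being
   the block xi_p; RK is this space with its Borel sigma-algebra. *)
Notation RK R K0 P := (g_sigma_algebraType (@open 'M[R]_(K0, P))).

Definition dotv (R : realType) (n : nat) (u v : 'cV[R]_n) : R :=
  \sum_(k < n) u k 0 * v k 0.

Definition is_norm (R : realType) (K0 P : nat) (nrm : 'M[R]_(K0, P) -> R) :=
  [/\ forall x y, nrm (x + y) <= nrm x + nrm y,
      forall a x, nrm (a *: x) = `|a| * nrm x
    & forall x, nrm x = 0 -> x = 0].

Definition dual_norm (R : realType) (K0 P : nat) (nrm : 'M[R]_(K0, P) -> R)
    (w : 'M[R]_(K0, P)) : R :=
  sup [set \sum_(k < K0) \sum_(p < P) w k p * y k p
      | y in [set y : 'M[R]_(K0, P) | nrm y <= 1]].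

Definition embed_block (R : realType) (K0 P : nat) (p : 'I_P) (v : 'cV[R]_K0) :
    'M[R]_(K0, P) :=
  \matrix_(k, p') (if p' == p then v k 0 else 0).

Definition is_block_dual_norm (R : realType) (K0 P : nat)
    (nrm : 'M[R]_(K0, P) -> R) (dnrm : 'cV[R]_K0 -> R) :=
  forall p v, dual_norm nrm (embed_block p v) = dnrm v.

Section empirical.
Local Open Scope ereal_scope.
Context (R : realType) (K0 P N : nat) (xi : 'I_N -> RK R K0 P).

Definition empirical (A : set (RK R K0 P)) : \bar R :=
  \sum_(i < N) (N%:R^-1)%:E * \d_(xi i) A.

Let weight_ge0 : (0 <= N%:R^-1 :> R)%R.
Proof. by rewrite invr_ge0. Qed.

Let mass (i : 'I_N) : {measure set (RK R K0 P) -> \bar R} :=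
  mscale (NngNum weight_ge0) \d_(xi i).

Let empiricalE A : empirical A = \sum_(i < N) mass i A.
Proof. by []. Qed.

Let empirical0 : empirical set0 = 0.
Proof. by rewrite empiricalE big1. Qed.

Let empirical_ge0 A : 0 <= empirical A.
Proof. by rewrite empiricalE; exact: sume_ge0. Qed.

Let empirical_sigma_additive : semi_sigma_additive empirical.
Proof.
move=> F mF tF mUF; rewrite [X in _ --> X](_ : _ =
    lim ((fun n => \sum_(0 <= i < n) empirical (F i)) @ \oo)).
  by apply: is_cvg_ereal_nneg_natsum => k _; exact: empirical_ge0.
rewrite empiricalE; under [in RHS]eq_fun do under eq_bigr do rewrite empiricalE.
rewrite nneseries_sum//; apply: eq_bigr => /= i _.
exact: measure_semi_bigcup.
Qed.

HB.instance Definition _ := isMeasure.Build _ _ _ empirical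
  empirical0 empirical_ge0 empirical_sigma_additive.

Lemma empirical_setT : (0 < N)%N -> empirical setT = 1.
Proof.
move=> N0; rewrite /empirical; under eq_bigr do rewrite diracT mule1.
rewrite sumEFin sumr_const card_ord -(mulr_natl N%:R^-1) mulfV//.
by rewrite pnatr_eq0 -lt0n.
Qed.

End empirical.

Definition coupling (R : realType) (K0 P : nat)
    (mu nu : {measure set (RK R K0 P) -> \bar R})
    (Pi : probability (RK R K0 P * RK R K0 P)%type R) :=
  forall A, measurable A ->
    pushforward Pi fst A = mu A /\ pushforward Pi snd A = nu A.

Definition wasserstein (R : realType) (K0 P : nat) (nrm : 'M[R]_(K0, P) -> R)
    (mu nu : {measure set (RK R K0 P) -> \bar R}) : \bar R :=
  ereal_inf [set (\int[Pi]_u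
      (nrm ((u.1 : 'M[R]_(K0, P)) - (u.2 : 'M[R]_(K0, P))))%:E)%E
    | Pi in [set Pi : probability (RK R K0 P * RK R K0 P)%type R
            | coupling mu nu Pi]].

Record ccdata (R : realType) (L K0 P N : nat) := CCData {
  cc_X : set 'cV[R]_L;
  cc_c : 'cV[R]_L;
  cc_A : 'M[R]_(L, K0);
  cc_b : 'cV[R]_K0;
  cc_a : 'I_P -> 'cV[R]_L;
  cc_d : 'I_P -> R;
  cc_eps : R;
  cc_theta : R;
  cc_norm : 'M[R]_(K0, P) -> R;
  cc_dnorm : 'cV[R]_K0 -> R; (* constrained by [is_block_dual_norm] *)
  cc_xi : 'I_N -> 'M[R]_(K0, P);
  cc_M : 'I_N -> R
}.

Record decision (R : realType) (L N : nat) := Decision {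
  dz : 'I_N -> bool;
  dt : R;
  dr : 'I_N -> R;
  dx : 'cV[R]_L
}.

Definition minimizer (R : realType) (T : Type) (f : T -> R) (S : set T) (s : T) :=
  S s /\ forall s', S s' -> f s <= f s'.

Section formulations.
Context (R : realType) (L K0 P N : nat) (D : ccdata R L K0 P N).

Definition wball : set (probability (RK R K0 P) R) :=
  [set mu | (wasserstein (cc_norm D) (empirical (cc_xi D)) mu <= (cc_theta D)%:E)%E].

Definition margin (x : 'cV[R]_L) (y : 'M[R]_(K0, P)) (p : 'I_P) : R :=
  dotv (cc_b D - (cc_A D)^T *m x) (col p y) + cc_d D p - dotv (cc_a D p) x.

Definition safe_open (x : 'cV[R]_L) : set (RK R K0 P) :=
  [set y | forall p, 0 < margin x y p].

Definition safe_closed (x : 'cV[R]_L) : set (RK R K0 P) :=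
  [set y | forall p, 0 <= margin x y p].

Definition X_DR (S : 'cV[R]_L -> set (RK R K0 P)) : set 'cV[R]_L :=
  [set x | cc_X D x /\
    (ereal_sup [set mu (~` S x) | mu in wball] <= (cc_eps D)%:E)%E].

Definition objx (x : 'cV[R]_L) : R := dotv (cc_c D) x.
Definition obj (s : decision R L N) : R := objx (dx s).

Definition rowvec (i : 'I_N) (p : 'I_P) : 'cV[R]_L :=
  - (cc_A D *m col p (cc_xi D i)) - cc_a D p.

Definition rhs (i : 'I_N) (p : 'I_P) : R :=
  dotv (cc_b D) (col p (cc_xi D i)) + cc_d D p.

(* floor (eps * N) *)
Definition kbudget : nat := Num.truncn (cc_eps D * N%:R).

Definition knapsack : set (decision R L N) :=
  [set s | let: Decision z t r x := s in
    (0 <= t /\ (forall i, 0 <= r i) /\ cc_X D x) /\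
    [/\ cc_theta D * cc_dnorm D (cc_b D - (cc_A D)^T *m x)
          + N%:R^-1 * (\sum_(i < N) r i) <= cc_eps D * t,
        forall i, t - r i <= cc_M D i * (1 - (z i)%:R),
        forall i p, t - r i <=
          dotv (rowvec i p) x + rhs i p + cc_M D i * (z i)%:R,
        (\sum_(i < N) z i <= kbudget)%N
      & forall i p, 0 <= dotv (rowvec i p) x + rhs i p + cc_M D i * (z i)%:R]].

Definition hbar (Xbar : set 'cV[R]_L) (j : 'I_N) (u : 'cV[R]_L) : \bar R :=
  ereal_inf [set (dotv u x)%:E | x in
    [set x | Xbar x /\ forall g, 0 <= dotv (rowvec j g) x + rhs j g]].

(* Sorted in nonincreasing order, so index [kbudget] is the (k+1)-th largest
   value; the default [-oo] is never used when 0 < eps < 1 and 0 < N. *)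
Definition quantile (Xbar : set 'cV[R]_L) (i : 'I_N) (p : 'I_P) : \bar R :=
  nth -oo%E
    (sort (fun u v : \bar R => (v <= u)%E)
      [seq hbar Xbar j (rowvec i p) | j <- enum 'I_N])
    kbudget.

Definition improved (q : 'I_N -> 'I_P -> R) : set (decision R L N) :=
  [set s | let: Decision z t r x := s in
    (0 <= t /\ (forall i, 0 <= r i) /\ cc_X D x) /\
    [/\ cc_theta D * cc_dnorm D (cc_b D - (cc_A D)^T *m x)
          + N%:R^-1 * (\sum_(i < N) r i) <= cc_eps D * t,
        forall i, t - r i <= cc_M D i * (1 - (z i)%:R),
        (\sum_(i < N) z i <= kbudget)%N,
        forall i p, q i p <= dotv (rowvec i p) x
      & forall i p, t - r i <=
          dotv (rowvec i p) x + rhs i p + (- rhs i p - q i p) * (z i)%:R]].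

End formulations.

(* Main.v *)
Require Import Defs.
From HB Require Import structures.
From mathcomp Require Import all_boot all_order all_algebra.
From mathcomp Require Import finmap.
From mathcomp Require Import all_classical all_reals all_analysis.
From mathcomp Require Import measurable_realfun.
From mathcomp Require Import ring lra.

Set Implicit Arguments.
Unset Strict Implicit.
Unset Printing Implicit Defensive.

Import Order.TTheory GRing.Theory Num.Theory.
Import numFieldNormedType.Exports.

Local Open Scope classical_set_scope.
Local Open Scope ring_scope.

(** Write [w = b - A^T x], [m i p] for the margin of sample [i] in constraint
[p], and [c] for the dual norm of [w].  A scenario [y'] is unsafe when some
margin is nonpositive (or negative); if [w <> 0], the distance from sample [i]
to the unsafe set is [g i / c], where [g i] is the positive part of the
smallest [m i p].  Robust feasibility of [x] then says that transporting mass
of the empirical distribution into the unsafe set at total cost at most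
[theta] never moves more than [eps], and [(t, r)] in the budget row is a
solution of the linear programming dual of this transport problem.

Sufficiency.  An improved-feasible [(z, t, r, x)] satisfies [t - r i <= g i]
for every sample, so [t] times the indicator of the unsafe set at [y'] is at
most [phi y + c * |y - y'|] for a function [phi] with [phi (xi i) <= r i].
Integrating against a coupling ([transport_bound]) and using the budget row
gives [t * mu(unsafe) <= eps * t], hence [certificate_X_DR_open].  When
[w = 0] all scenarios have the same margins, and a counting argument
([certificate_degenerate]) shows that they are nonnegative; if in addition
[d_p <> a_p^T x] they are positive, which settles the open safety set.

Necessity.  Given [x] in the closed robust set, let [t] be the [(k+1)]-th
smallest [g i] and [r i] the excess of [t] over [g i].  If the budget row
failed, sending the [k] samples nearest to the unsafe set there, together with
slightly more than [eps - k/N] of the next one, would cost at most [theta] and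
carry more than [eps] ([exists_discrete_transport]); so [x] extends to a
knapsack-feasible point ([closed_feasible_knapsack]).

Quantiles.  In a knapsack-feasible point with [x] in [Xbar], every [j] with
[z j = 0] makes [x] a competitor in the minimum defining [hbar j].  At most [k]
indices have [z j = 1], so one of the [k+1] largest [hbar j] is bounded by the
row value at [x], and so is [q]: the point is improved-feasible
([knapsack_improved]).  Improved feasibility thus implies closed robust
feasibility, which implies knapsack feasibility, and an optimal knapsack point
with [x] in [Xbar] closes the chain: it is optimal for the improved formulation
and for the closed robust program. *)

(** * Norms on matrices *)

Lemma coord_le_mx_norm (R : realType) (m n : nat) (x : 'M[R]_(m, n)) i j :
  `|x i j| <= `|x|.
Proof.
by rewrite [leRHS]/Num.norm /= mx_normrE; apply/bigmax_geP; right; exists (i, j).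
Qed.

Section norms.
Context {R : realType} {K0 P : nat} {nrm : 'M[R]_(K0, P) -> R}.
Hypothesis Hnrm : is_norm nrm.

Lemma nrm0 : nrm 0 = 0.
Proof. by case: Hnrm => _ + _ => /(_ 0 0); rewrite scale0r normr0 mul0r. Qed.

Lemma nrmN x : nrm (- x) = nrm x.
Proof. by case: Hnrm => _ + _ => /(_ (-1) x); rewrite scaleN1r normrN1 mul1r. Qed.

Lemma nrm_ge0 x : 0 <= nrm x.
Proof.
by case: Hnrm => /(_ x (- x)) + _ _; rewrite subrr nrm0 nrmN; lra.
Qed.

Lemma nrm_sum (I : Type) (s : seq I) (F : I -> 'M[R]_(K0, P)) :
  nrm (\sum_(i <- s) F i) <= \sum_(i <- s) nrm (F i).
Proof.
elim/big_ind2 : _ => [|a x b y ax by_|//]; first by rewrite nrm0.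
by case: Hnrm => /(_ x y) + _ _; lra.
Qed.

Lemma nrm_le_mx_norm : exists2 C, 0 < C & forall x, nrm x <= C * `|x|.
Proof.
exists (1 + \sum_i \sum_j nrm (delta_mx i j)).
  by apply: ltr_pwDl => //; do 2!(apply: sumr_ge0 => ? _); exact: nrm_ge0.
move=> x; rewrite {1}(matrix_sum_delta x).
apply: (@le_trans _ _ (\sum_i \sum_j `|x| * nrm (delta_mx i j))).
  apply: le_trans (nrm_sum _ _) _; apply: ler_sum => i _.
  apply: le_trans (nrm_sum _ _) _; apply: ler_sum => j _.
  case: Hnrm => _ -> _; apply: ler_wpM2r; first exact: nrm_ge0.
  exact: coord_le_mx_norm.
under eq_bigr do rewrite -mulr_sumr.
by rewrite -mulr_sumr mulrC ler_wpM2r// lerDr.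
Qed.

(** Continuity is with respect to the sup norm carried by the matrix space, not
to [nrm] itself. *)
Lemma nrm_continuous : continuous nrm.
Proof.
have [C C0 HC] := nrm_le_mx_norm.
move=> x; apply/(@cvgrPdist_lt _ _ _ (nbhs x)) => e e0; near=> y.
have h u v : nrm u - nrm v <= nrm (u - v).
  by case: Hnrm => /(_ (u - v) v) + _ _; rewrite subrK; lra.
apply: (@le_lt_trans _ _ (nrm (x - y))).
  have := h y x; rewrite -(nrmN (y - x)) opprB => hyx.
  by rewrite ler_norml h andbT lerNl opprB.
apply: le_lt_trans (HC _) _; rewrite mulrC -ltr_pdivlMr//.
near: y; move: (e / C) (divr_gt0 e0 C0).
by apply/(@cvgrPdist_lt _ _ _ (nbhs x)); exact: cvg_id.
Unshelve. all: by end_near. Qed.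

(** Half of the equivalence of norms in finite dimension: [nrm] is continuous
and does not vanish on the compact unit sphere of the sup norm, so it has a
positive minimum there.  Flattening matrices to rows gives access to the
Heine-Borel theorem [bounded_closed_compact]. *)
Lemma coord_le_nrm : exists C, forall (x : 'M[R]_(K0, P)) i j, `|x i j| <= C * nrm x.
Proof.
pose f (v : 'rV[R]_(K0 * P)) := nrm (vec_mx v).
have cf : continuous f.
  move=> v; apply: continuous_comp; last exact: nrm_continuous.
  apply/(@cvgrPdist_le _ _ _ (nbhs v)) => e e0; near=> u.
  rewrite [leLHS]/Num.norm /= mx_normrE; apply/bigmax_leP; split=> [|[i j] _ /=].
    exact: ltW.
  rewrite !mxE; apply: (@le_trans _ _ `|v - u|).
    by have := coord_le_mx_norm (v - u) 0 (mxvec_index i j); rewrite !mxE.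
  near: u; move: (e) e0.
  by apply/(@cvgrPdist_le _ _ _ (nbhs v)); exact: cvg_id.
pose S := [set v : 'rV[R]_(K0 * P) | `|v| = 1].
have unitS x : x != 0 -> S (`|mxvec x|^-1 *: mxvec x).
  move=> x0; rewrite /S /= normrZ normfV normr_id mulVf// normr_eq0.
  by apply: contra_neq x0 => x0; rewrite -(mxvecK x) x0 linear0.
(* The sphere is empty exactly when the matrices have no entry. *)
have [S0|S0] := pselect (S !=set0); last first.
  exists 0 => x i j; rewrite mul0r; have [->|/unitS Sx] := eqVneq x 0.
    by rewrite mxE normr0.
  by case: S0; eexists; exact: Sx.
have cS : compact S.
  apply: bounded_closed_compact.
    by exists 1; split=> // y y1 v /= ->; exact: ltW.
  have -> : S = (fun v : 'rV[R]_(K0 * P) => `|v|) @^-1` [set 1] by [].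
  by apply: closed_comp => [v _|]; [exact: norm_continuous|exact: closed_eq].
have [v vS vmin] := EVT_min_rV S0 cS (continuous_subspaceT cf).
have fv0 : 0 < f v.
  rewrite lt_neqAle nrm_ge0 andbT eq_sym; apply/eqP.
  case: Hnrm => _ _ /[apply] v0; move: vS; rewrite inE /S /=.
  by rewrite -(vec_mxK v) v0 linear0 normr0 => /eqP; rewrite eq_sym oner_eq0.
exists (f v)^-1 => x i j; rewrite mulrC ler_pdivlMr//.
have [->|x0] := eqVneq x 0; first by rewrite mxE normr0 mul0r nrm_ge0.
have := vmin _ (mem_set (unitS _ x0)); rewrite {2}/f linearZ/= mxvecK.
case: Hnrm => _ -> _; rewrite normfV normr_id => fvx.
have a0 : 0 < `|mxvec x|.
  rewrite normr_gt0; apply: contra_neq x0 => x0.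
  by rewrite -(mxvecK x) x0 linear0.
move: fvx; rewrite mulrC ler_pdivlMr// mulrC; apply: le_trans.
apply: ler_wpM2r; first exact: ltW.
by rewrite -(mxvecE x i j); exact: coord_le_mx_norm.
Unshelve. all: by end_near. Qed.

End norms.

(** * The dual norm of a block *)

Section dotv_linear.
Context {R : realType} {n : nat}.
Implicit Types u v w : 'cV[R]_n.

Lemma dotvDl u v w : dotv (u + v) w = dotv u w + dotv v w.
Proof. by rewrite -big_split; apply: eq_bigr => k _; rewrite mxE mulrDl. Qed.

Lemma dotvZr a u v : dotv u (a *: v) = a * dotv u v.
Proof. by rewrite mulr_sumr; apply: eq_bigr => k _; rewrite mxE; ring. Qed.

Lemma dotvC u v : dotv u v = dotv v u.
Proof. by apply: eq_bigr => k _; rewrite mulrC. Qed.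

Lemma dotvNl u v : dotv (- u) v = - dotv u v.
Proof. by rewrite -scaleN1r dotvC dotvZr mulN1r dotvC. Qed.

Lemma dotvDr u v w : dotv u (v + w) = dotv u v + dotv u w.
Proof. by rewrite dotvC dotvDl !(dotvC u). Qed.

Lemma dotvNr u v : dotv u (- v) = - dotv u v.
Proof. by rewrite dotvC dotvNl dotvC. Qed.

Lemma dotv0l u : dotv 0 u = 0.
Proof. by apply: big1 => k _; rewrite mxE mul0r. Qed.

Lemma dotvv_gt0 v : v != 0 -> 0 < dotv v v.
Proof.
move=> v0; rewrite lt_neqAle sumr_ge0 ?andbT => [|k _]; last exact: sqr_ge0.
apply: contra_neq v0 => /esym/eqP; rewrite psumr_eq0 => [/allP v0|k _]; last first.
  exact: sqr_ge0.
apply/matrixP => k j; rewrite mxE ord1.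
by have := v0 k (mem_index_enum k); rewrite mulf_eq0 orbb => /eqP.
Qed.

End dotv_linear.

Lemma dotv_mulmx (R : realType) (m n : nat) (A : 'M[R]_(m, n)) u v :
  dotv u (A *m v) = dotv (A^T *m u) v.
Proof.
rewrite /dotv; under eq_bigr do rewrite mxE mulr_sumr.
rewrite exchange_big; apply: eq_bigr => j _; rewrite mxE mulr_suml.
by apply: eq_bigr => i _; rewrite mxE; ring.
Qed.

Section dual_norm_theory.
Context {R : realType} {K0 P : nat} {nrm : 'M[R]_(K0, P) -> R}.
Context {dnrm : 'cV[R]_K0 -> R}.
Hypotheses (Hnrm : is_norm nrm) (Hdnrm : is_block_dual_norm nrm dnrm).

Lemma embed_block_pairing p (v : 'cV[R]_K0) (y : 'M[R]_(K0, P)) :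
  \sum_(k < K0) \sum_(p' < P) embed_block p v k p' * y k p' = dotv v (col p y).
Proof.
apply: eq_bigr => k _; rewrite (bigD1 p)//= big1 ?addr0 => [|p' /negbTE p'p].
  by rewrite !mxE eqxx.
by rewrite mxE p'p mul0r.
Qed.

(** The supremum defining the dual norm is a genuine one because coordinates are
bounded by [nrm]; on an unbounded set [sup] is a default value. *)
Lemma has_sup_dual p v : has_sup
  [set \sum_(k < K0) \sum_(p' < P) embed_block p v k p' * y k p'
      | y in [set y : 'M[R]_(K0, P) | nrm y <= 1]].
Proof.
split; first by exists 0, 0; rewrite /= ?(nrm0 Hnrm)// embed_block_pairing
  /dotv big1// => k _; rewrite !mxE mulr0.
have [C HC] := coord_le_nrm Hnrm.
exists (\sum_k `|v k 0| * `|C|) => _ [y /= y1 <-].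
rewrite embed_block_pairing; apply: ler_sum => k _.
apply: (le_trans (ler_norm _)); rewrite normrM ler_wpM2l// mxE.
apply: le_trans (HC _ _ _) _; have := nrm_ge0 Hnrm y => y0.
by apply: (@le_trans _ _ (`|C| * nrm y)); rewrite ?ler_wpM2r ?ler_norm ?ler_piMr.
Qed.

Lemma dual_norm_approx p v a : a < dnrm v ->
  exists2 y, nrm y <= 1 & a < dotv v (col p y).
Proof.
rewrite -(Hdnrm p) => /(sup_gt (has_sup_dual p v).1)[_ [y y1 <-]] ay.
by exists y => //; rewrite -embed_block_pairing.
Qed.

Lemma dual_norm_ge p v y : nrm y <= 1 -> dotv v (col p y) <= dnrm v.
Proof.
move=> y1; rewrite -(Hdnrm p) -embed_block_pairing.
by apply: ub_le_sup; [exact: (has_sup_dual p v).2|exists y].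
Qed.

Lemma dual_norm_holder p v y : dotv v (col p y) <= dnrm v * nrm y.
Proof.
have [y0|y0] := eqVneq (nrm y) 0.
  case: Hnrm => _ _ /(_ _ y0) ->.
  by rewrite (nrm0 Hnrm) mulr0 /dotv big1// => k _; rewrite !mxE mulr0.
have {}y0 : 0 < nrm y by rewrite lt_neqAle eq_sym y0 (nrm_ge0 Hnrm).
rewrite -ler_pdivrMr// mulrC -dotvZr.
have -> : (nrm y)^-1 *: col p y = col p ((nrm y)^-1 *: y).
  by apply/matrixP => i j; rewrite !mxE.
apply: dual_norm_ge; case: Hnrm => _ -> _.
by rewrite ger0_norm ?mulVf ?gt_eqF// invr_ge0 ltW.
Qed.

Lemma dual_norm_gt0 (p : 'I_P) v : v != 0 -> 0 < dnrm v.
Proof.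
move=> v0; have := dual_norm_holder p v (embed_block p v).
have -> : col p (embed_block p v) = v.
  by apply/matrixP => i j; rewrite !mxE eqxx ord1.
move=> /(lt_le_trans (dotvv_gt0 v0)); have := nrm_ge0 Hnrm (embed_block p v).
by rewrite le_eqVlt => /predU1P[<-|]; [rewrite mulr0 ltxx|move=> ?; rewrite pmulr_lgt0].
Qed.

Lemma dual_norm0 (p : 'I_P) : dnrm 0 = 0.
Proof.
apply/eqP; rewrite eq_le; apply/andP; split; last first.
  have := @dual_norm_ge p 0 0; rewrite (nrm0 Hnrm) dotv0l; exact.
rewrite leNgt; apply/negP => /(dual_norm_approx p)[y _].
by rewrite dotv0l ltxx.
Qed.

End dual_norm_theory.

(** * Discrete measures, lower integrals, measurability *)

Section discrete_measure.
Local Open Scope ereal_scope.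
Context d (T : measurableType d) (R : realType) (I : finType).
Variables (a : I -> {nonneg R}) (x : I -> T).

(* [msum] sums a sequence of measures indexed by [nat], so the finite type [I]
   is enumerated; [mzero] fills the indices beyond its cardinal. *)
Let atom (j : 'I_#|I|) : {measure set T -> \bar R} :=
  mscale (a (enum_val j)) \d_(x (enum_val j)).

Let atom_nat (k : nat) : {measure set T -> \bar R} :=
  oapp atom (mzero : {measure set T -> \bar R}) (insub k).

Let atoms : set T -> \bar R := msum atom_nat #|I|.

Let atomsE A : atoms A = \sum_i (a i)%:num%:E * \d_(x i) A.
Proof.
rewrite [RHS](reindex _ (onW_bij _ (@enum_val_bij I))).
by apply: eq_bigr => j _; rewrite /atom_nat valK.
Qed.

Hypothesis a1 : (\sum_i (a i)%:num = 1)%R.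

Let atoms_setT : atoms setT = 1.
Proof.
rewrite atomsE; under eq_bigr do rewrite diracT mule1.
by rewrite sumEFin a1.
Qed.

Definition discrete_probability : probability T R :=
  HB.pack (msum atom_nat #|I|)
    (Measure_isProbability.Build _ _ _ (msum atom_nat #|I|) atoms_setT).

Lemma discrete_probabilityE A :
  discrete_probability A = \sum_i (a i)%:num%:E * \d_(x i) A.
Proof. exact: atomsE. Qed.

End discrete_measure.

Section lower_integral.
Local Open Scope ereal_scope.
Context d (T : measurableType d) (R : realType).
Variable mu : {measure set T -> \bar R}.
Import HBNNSimple.

(** The integral of a nonnegative function is by definition a supremum over
simple functions below it, hence monotone without any measurability.  The
transport cost of an arbitrary norm, on the product sigma-algebra, is bounded
from both sides through this monotonicity alone. *)
Lemma ge0_le_integral_nonmeasurable (f g : T -> \bar R) :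
  (forall x, 0 <= f x) -> (forall x, f x <= g x) ->
  \int[mu]_x f x <= \int[mu]_x g x.
Proof.
move=> f0 fg; rewrite !ge0_integralTE// => [|x]; last exact: le_trans (fg x).
by apply: le_ereal_sup => _ [h /= hf <-]; exists h => // x; exact: le_trans (fg x).
Qed.

(** Only the upper bound holds for every [f]: a simple function below [f] is
integrated exactly, and its value at an atom is at most that of [f]. *)
Lemma integral_atoms_le (I : finType) (a : I -> R) (x : I -> T) (f : T -> R) :
  (forall A, measurable A -> mu A = \sum_i (a i)%:E * \d_(x i) A) ->
  (forall i, (0 <= a i)%R) -> (forall y, (0 <= f y)%R) ->
  \int[mu]_y (f y)%:E <= (\sum_i a i * f (x i))%:E.
Proof.
move=> muE a0 f0; rewrite ge0_integralTE => [|y]; last by rewrite lee_fin.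
apply: ge_ereal_sup => _ [h /= hf <-].
rewrite sintegralE fsbig_finite//=.
under eq_bigr => r _.
  rewrite muE; last exact: measurable_sfunP.
  rewrite ge0_sume_distrr; last by move=> i _; rewrite mule_ge0// lee_fin.
  over.
rewrite exchange_big/= -sumEFin; apply: lee_sum => i _.
have hi : h (x i) \in fset_set (range h).
  by rewrite in_fset_set// inE; exists (x i).
rewrite (big_fsetD1 _ hi)/= big1_fset ?adde0 => [|r]; last first.
  rewrite !inE => /andP[/eqP rh _] _.
  rewrite diracE memNset/= ?mule0// => /esym; exact.
rewrite diracE mem_set//= mule1 -EFinM lee_fin mulrC ler_wpM2l//.
by have := hf (x i); rewrite lee_fin.
Qed.

End lower_integral.

Section measurable_coordinates.
Context {R : realType} {K0 P : nat}.

Lemma measurable_RK_open (A : set 'M[R]_(K0, P)) :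
  open A -> measurable (A : set (RK R K0 P)).
Proof. by move=> oA; exact: sub_sigma_algebra. Qed.

Lemma measurable_RK_continuous (f : 'M[R]_(K0, P) -> R) :
  continuous f -> measurable_fun setT (f : RK R K0 P -> R).
Proof.
move=> cf; apply: (measurability _ (RGenOInfty.measurableE R)) => _ [_ [a ->] <-].
rewrite setTI; apply: measurable_RK_open.
by apply: open_comp; [move=> ? _; exact: cf|exact: interval_open].
Qed.

End measurable_coordinates.

Lemma measurable_bigmaxr d (T : measurableType d) (R : realType) (I : Type)
    (s : seq I) (f : I -> T -> R) (a : R) :
  (forall i, measurable_fun setT (f i)) ->
  measurable_fun setT (fun x => \big[Num.max/a]_(i <- s) f i x).
Proof.
move=> mf; elim: s => [|i s IHs].
  by under eq_fun do rewrite big_nil; exact: measurable_cst.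
by under eq_fun do rewrite big_cons; exact: measurable_maxr.
Qed.

(** * Upper bound on the mass of a set in a Wasserstein ball *)

Section transport_bound.
Context {R : realType} {K0 P N : nat} {nrm : 'M[R]_(K0, P) -> R}.
Variables (xi : 'I_N -> 'M[R]_(K0, P)) (mu : probability (RK R K0 P) R).
Variables (U : set (RK R K0 P)) (phi : RK R K0 P -> R) (t c : R).
Hypotheses (Hnrm : is_norm nrm) (mU : measurable U) (t0 : 0 <= t) (c0 : 0 < c).
Hypotheses (phi0 : forall y, 0 <= phi y) (mphi : measurable_fun setT phi).
Hypothesis reach : forall y y' : 'M[R]_(K0, P),
  U y' -> t <= phi y + c * nrm (y - y').

(* The function [h] is the part of the target indicator that [phi] does not
   cover.  It is measurable and lies below [c] times the cost, so the cost
   itself enters only through monotonicity of the integral. *)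
Let transport_bound_coupling (Pi : probability (RK R K0 P * RK R K0 P)%type R) :
  coupling (empirical xi) mu Pi ->
  (t%:E * mu U <= (N%:R^-1 * \sum_i phi (xi i))%:E +
     c%:E * \int[Pi]_u (nrm ((u.1 : 'M[R]_(K0, P)) - (u.2 : 'M[R]_(K0, P))))%:E)%E.
Proof.
move=> Picoupling.
pose RR := (RK R K0 P * RK R K0 P)%type.
pose tU (u : RR) : R := t * \1_U u.2.
pose phi1 (u : RR) : R := phi u.1.
pose h (u : RR) : R := Num.max 0 (tU u - phi1 u).
have mEFin (g : RR -> R) : measurable_fun setT g ->
    measurable_fun setT (fun u => (g u)%:E) by move=> mg; exact/measurable_EFinP.
have mtU : measurable_fun setT tU.
  apply: measurable_funM => //.
  exact: (measurableT_comp (measurable_indic mU) measurable_snd).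
have mphi1 : measurable_fun setT phi1 by apply: measurableT_comp.
have mh : measurable_fun setT h.
  by apply: measurable_maxr => //; apply: measurable_funB.
have tU0 u : 0 <= tU u by rewrite mulr_ge0// indicE ler0n.
have h0 u : 0 <= h u by rewrite le_max lexx.
have -> : (t%:E * mu U = \int[Pi]_u (tU u)%:E)%E.
  under eq_integral do rewrite EFinM.
  rewrite ge0_integralZl//; last first.
    by apply: mEFin; exact: (measurableT_comp (measurable_indic mU) measurable_snd).
  have -> : (\int[Pi]_u (\1_U u.2)%:E = \int[Pi]_u (\1_(snd @^-1` U) u)%:E)%E.
    by apply: eq_integral => u _; rewrite !indicE; congr ((_ : bool)%:R%:E);
      rewrite !inE.
  rewrite integral_indic//; last first.
    by rewrite -[X in measurable X]setTI; exact: measurable_snd.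
  by rewrite setIT; have [_ <-] := Picoupling _ mU.
apply: (@le_trans _ _ (\int[Pi]_u ((phi1 u)%:E + (h u)%:E))%E).
  apply: ge0_le_integral_nonmeasurable => u; first by rewrite lee_fin.
  by rewrite -EFinD lee_fin -lerBlDl le_max lexx orbT.
rewrite ge0_integralD//; last 4 first.
- by move=> u _; rewrite lee_fin; exact: phi0.
- exact: mEFin.
- by move=> u _; rewrite lee_fin.
- exact: mEFin.
apply: leeD.
  have := @ge0_integral_pushforward _ _ _ _ R _ measurable_fst Pi setT
    (fun y => (phi y)%:E) measurableT.
  rewrite preimage_setT => <-//; last 2 first.
  - exact/measurable_EFinP.
  - by move=> y _; rewrite lee_fin.
  rewrite mulr_sumr; apply: integral_atoms_le => // A mA.
  exact: (Picoupling _ mA).1.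
have -> : (\int[Pi]_u (h u)%:E = c%:E * \int[Pi]_u (c^-1 * h u)%:E)%E.
  rewrite -ge0_integralZl//; last 3 first.
  - by apply: mEFin; exact: measurable_funM.
  - by move=> u _; rewrite lee_fin mulr_ge0// invr_ge0 ltW.
  - by rewrite lee_fin ltW.
  by apply: eq_integral => u _; rewrite -EFinM mulVKf// gt_eqF.
apply: lee_wpmul2l; first by rewrite lee_fin ltW.
apply: ge0_le_integral_nonmeasurable => u.
  by rewrite lee_fin mulr_ge0// invr_ge0 ltW.
rewrite lee_fin mulrC ler_pdivrMr// ge_max mulr_ge0 ?(nrm_ge0 Hnrm) ?(ltW c0)//=.
rewrite lerBlDl mulrC /tU indicE; case: (boolP (u.2 \in U)) => [|_].
  by rewrite inE mulr1 => /reach; exact.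
by rewrite mulr0 addr_ge0 ?phi0// mulr_ge0 ?(nrm_ge0 Hnrm)// ltW.
Qed.

(** Weak duality for the worst-case probability of [U]: [c] is the multiplier of
the Wasserstein constraint and [phi] the dual function on the sample space. *)
Lemma transport_bound theta :
  (wasserstein nrm (empirical xi) mu <= theta%:E)%E ->
  (t%:E * mu U <= (N%:R^-1 * \sum_i phi (xi i) + c * theta)%:E)%E.
Proof.
move=> Wtheta; set s := N%:R^-1 * _.
have muU : mu U = (fine (mu U))%:E by rewrite fineK// fin_num_measure.
rewrite muU -EFinM lee_fin -lerBlDl [leRHS]mulrC -ler_pdivrMr//.
rewrite -(@lee_fin R _ theta).
apply: le_trans Wtheta; apply: le_ereal_inf_tmp => _ [Pi /transport_bound_coupling + <-].
rewrite muU; case: (\int[Pi]_u _)%E => [v|_|]; last 2 first.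
- by rewrite leey.
- by rewrite gt0_muleNy// -EFinM.
by rewrite -!EFinM -EFinD !lee_fin ler_pdivrMr// lerBlDl [c * v]mulrC.
Qed.

End transport_bound.

(** * Distributions in a Wasserstein ball *)

(** The plan moves mass [w i] from sample [i] to [zeta i] and leaves the rest in
place; its second marginal is the required distribution. *)
Lemma exists_discrete_transport (R : realType) (K0 P N : nat)
    (nrm : 'M[R]_(K0, P) -> R) (xi zeta : 'I_N -> 'M[R]_(K0, P))
    (w : 'I_N -> R) (theta : R) :
  is_norm nrm -> (0 < N)%N -> (forall i, 0 <= w i <= N%:R^-1) ->
  \sum_i w i * nrm (xi i - zeta i) <= theta ->
  exists2 nu : probability (RK R K0 P) R,
    (wasserstein nrm (empirical xi) nu <= theta%:E)%E &
    forall U, (forall i, 0 < w i -> U (zeta i)) -> ((\sum_i w i)%:E <= nu U)%E.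
Proof.
move=> Hnrm N0 w01 cost_le.
(* The boolean tells the moved part of sample [u.1] from the part left there. *)
pose mass (u : 'I_N * bool) : R := if u.2 then w u.1 else N%:R^-1 - w u.1.
have mass_ge0 u : 0 <= mass u.
  by rewrite /mass; case: ifP => _; rewrite ?subr_ge0; have /andP[] := w01 u.1.
pose a u : {nonneg R} := NngNum (mass_ge0 u).
pose dest (u : 'I_N * bool) : RK R K0 P := if u.2 then zeta u.1 else xi u.1.
pose path (u : 'I_N * bool) : RK R K0 P * RK R K0 P := (xi u.1, dest u).
have sum_mass (f : 'I_N * bool -> R) :
    \sum_u mass u * f u =
    \sum_i (w i * f (i, true) + (N%:R^-1 - w i) * f (i, false)).
  transitivity (\sum_(i < N) \sum_(b : bool) mass (i, b) * f (i, b)).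
    by rewrite pair_bigA; apply: eq_bigr => -[].
  by apply: eq_bigr => i _; rewrite big_bool.
have a1 : \sum_u (a u)%:num = 1.
  have := sum_mass (fun=> 1); under eq_bigr do rewrite mulr1.
  move=> ->; under eq_bigr do rewrite !mulr1 addrC subrK.
  by rewrite sumr_const card_ord -(mulr_natl N%:R^-1) mulfV// pnatr_eq0 -lt0n.
have sumE (y : 'I_N * bool -> RK R K0 P) A :
    (\sum_u (a u)%:num%:E * \d_(y u) A = (\sum_u mass u * \1_A (y u))%:E)%E.
  by rewrite -sumEFin; apply: eq_bigr => u _; rewrite EFinM.
exists (discrete_probability dest a1); last first.
  move=> U wU; rewrite discrete_probabilityE sumE lee_fin sum_mass.
  apply: ler_sum => i _; have /andP[wi0 wi1] := w01 i.
  rewrite ler_wpDr ?mulr_ge0 ?subr_ge0 ?indicE//.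
  have [<-|wi] := eqVneq 0 (w i); first by rewrite mul0r.
  by rewrite mem_set ?mulr1//; apply: wU; rewrite lt_neqAle wi.
apply: (@le_trans _ _ (\sum_u mass u * nrm (((path u).1 : 'M[R]_(K0, P)) -
    ((path u).2 : 'M[R]_(K0, P))))%:E); last first.
  rewrite lee_fin sum_mass; apply: le_trans cost_le; apply: ler_sum => i _.
  by rewrite /path/= subrr (nrm0 Hnrm) mulr0 addr0.
pose Pi := discrete_probability path a1.
apply: (@le_trans _ _ (\int[Pi]_u (nrm ((u.1 : 'M[R]_(K0, P)) -
    (u.2 : 'M[R]_(K0, P))))%:E)%E); last first.
  apply: (integral_atoms_le (mu := Pi)
    (f := fun u => nrm ((u.1 : 'M[R]_(K0, P)) - (u.2 : 'M[R]_(K0, P))))) => //.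
    by move=> A _; exact: discrete_probabilityE.
  by move=> u; exact: nrm_ge0.
apply: ereal_inf_lbound; exists Pi => // A mA.
rewrite /pushforward; split; last first.
  rewrite discrete_probabilityE; exact/esym/(discrete_probabilityE dest a1 A).
rewrite discrete_probabilityE.
transitivity (\sum_u (a u)%:num%:E * \d_(xi u.1 : RK R K0 P) A)%E => //.
rewrite sumE sum_mass/= /empirical; under [RHS]eq_bigr do rewrite -EFinM.
by rewrite sumEFin; congr (_%:E); apply: eq_bigr => i _; rewrite -mulrDl addrC subrK.
Qed.

(** * Order statistics *)

(** If the entry at index [k] of the nonincreasing list exceeded [v], so would
the [k.+1] first entries, yet only indices in [z] can exceed [v]. *)
Lemma nth_sort_le_but_few d (T : orderType d) (N k : nat) (h : 'I_N -> T) (x0 v : T)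
    (z : pred 'I_N) :
  (k < N)%N -> (\sum_i z i <= k)%N -> (forall j, ~~ z j -> (h j <= v)%O) ->
  (nth x0 (sort (fun u v => (v <= u)%O) [seq h j | j <- enum 'I_N]) k <= v)%O.
Proof.
move=> kN zk hv; rewrite leNgt; apply/negP => vq.
set s := sort _ _ in vq.
have ss : sorted (fun u v => (v <= u)%O) s.
  by apply: sort_sorted => x y; exact: le_total.
have sizes : size s = N by rewrite size_sort size_map size_enum_ord.
have : (k.+1 <= count (fun u => (v < u)%O) s)%N.
  rewrite -(cat_take_drop k.+1 s) count_cat.
  apply: leq_trans (leq_addr _ _).
  have : all (fun u => (v < u)%O) (take k.+1 s).
    apply/(all_nthP x0) => i; rewrite size_take sizes.
    rewrite (_ : (if (k.+1 < N)%N then k.+1 else N) = k.+1); last first.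
      by case: ltnP => // Nk; apply/eqP; rewrite eqn_leq Nk kN.
    move=> ik; rewrite nth_take//; apply: lt_le_trans vq _.
    apply: (sorted_leq_nth _ _ x0 ss) => //.
    - by move=> x y w xy yw; exact: le_trans yw xy.
    - by rewrite inE sizes (leq_trans ik).
    - by rewrite inE sizes.
  by rewrite all_count => /eqP ->; rewrite size_take sizes; case: ifP.
rewrite (permP (permEl (perm_sort _ _))) count_map -sum1_count big_enum_cond/=.
rewrite ltnNge => /negP; apply; apply: leq_trans zk.
rewrite big_mkcond/=; apply: leq_sum => j _; case: ifPn => // vj.
by case: (boolP (z j)) => // /hv; rewrite leNgt vj.
Qed.

(** A set of [k] smallest values of [g] together with a next smallest one; it
plays the role of sorting while keeping the original indices. *)
Lemma exists_order_threshold (R : realType) (N k : nat) (g : 'I_N -> R) :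
  (k < N)%N -> exists (S : {set 'I_N}) (i0 : 'I_N),
    [/\ #|S| = k, i0 \notin S, forall i, i \in S -> g i <= g i0
      & forall i, i \notin S -> g i0 <= g i].
Proof.
have least (S : {set 'I_N}) : (#|S| < N)%N ->
    exists2 i0, i0 \notin S & forall i, i \notin S -> g i0 <= g i.
  move=> SN; have /card_gt0P[j jS] : (0 < #|~: S|)%N.
    by rewrite cardsCs finset.setCK card_ord subn_gt0.
  rewrite inE in jS; case: (arg_minP g (P := fun i => i \notin S) jS) => i iS imin.
  by exists i.
move=> kN; suff [S [cS gS]] : exists S : {set 'I_N}, #|S| = k /\
    forall i j, i \in S -> j \notin S -> g i <= g j.
  have [|i0 i0S i0min] := least S; first by rewrite cS.
  by exists S, i0; split => // i iS; exact: gS.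
elim: k kN => [|k IHk] kN.
  by exists finset.set0; rewrite cards0; split => // i j; rewrite inE.
have [S [cS gS]] := IHk (ltnW kN).
have [|i0 i0S i0min] := least S; first by rewrite cS ltnW.
exists (i0 |: S)%SET; split; first by rewrite cardsU1 i0S cS.
move=> i j; rewrite !inE negb_or => /orP[/eqP ->|iS] /andP[_ jS]; first exact: i0min.
exact: gS.
Qed.

(** * Margins and safety sets *)

Section data.
Context {R : realType} {L K0 P N : nat} {D : ccdata R L K0 P N}.
Hypotheses (HN : (0 < N)%N) (Hrisk : 0 < cc_eps D < 1) (Hradius : 0 < cc_theta D).
Hypotheses (Hnrm : is_norm (cc_norm D))
  (Hdnrm : is_block_dual_norm (cc_norm D) (cc_dnorm D)).
Implicit Types (x : 'cV[R]_L) (y : 'M[R]_(K0, P)) (p : 'I_P).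

Let w x := cc_b D - (cc_A D)^T *m x.

Lemma sample_margin i p x :
  dotv (rowvec D i p) x + rhs D i p = margin D x (cc_xi D i) p.
Proof.
rewrite /margin /rhs !dotvDl !dotvNl -dotv_mulmx (dotvC _ x); ring.
Qed.

Lemma marginB x y y' p :
  margin D x y p - margin D x y' p = dotv (w x) (col p (y - y')).
Proof.
have -> : col p (y - y') = col p y - col p y' by apply/matrixP => i j; rewrite !mxE.
by rewrite /margin -/(w x) dotvDr dotvNr; ring.
Qed.

Lemma margin_degenerate x y p : w x = 0 ->
  margin D x y p = cc_d D p - dotv (cc_a D p) x.
Proof. by move=> w0; rewrite /margin -/(w x) w0 dotv0l add0r. Qed.

(** Hoelder's inequality: reaching a scenario of margin at most [0] from [y]
costs at least the margin at [y] divided by the dual norm. *)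
Lemma margin_le x y y' p :
  margin D x y p <= margin D x y' p + cc_dnorm D (w x) * cc_norm D (y - y').
Proof. by rewrite -lerBlDl marginB; exact: dual_norm_holder. Qed.

Lemma margin_continuous x p : continuous (fun y => margin D x y p).
Proof.
move=> y; rewrite /margin; apply: (@cvgB _ _ _ (nbhs y)); last exact: cvg_cst.
apply: (@cvgD _ _ _ (nbhs y)); last exact: cvg_cst.
apply: (@cvg_big _ _ _ _ _ _ _ (nbhs y)) => [|k _]; first exact: add_continuous.
apply: (@cvgM _ _ (nbhs y)); first exact: cvg_cst.
under eq_fun do rewrite mxE.
by rewrite mxE; exact: coord_continuous.
Qed.

Lemma measurable_margin x p :
  measurable_fun setT (fun y : RK R K0 P => margin D x y p).
Proof. by apply: measurable_RK_continuous; exact: margin_continuous. Qed.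

Lemma measurable_safe_open x : measurable (safe_open D x).
Proof.
have -> : safe_open D x =
    \bigcap_(p in [set: 'I_P]) [set y : RK R K0 P | 0 < margin D x y p].
  by apply/seteqP; split=> y /= h p; [move=> _; exact: h|exact: h].
apply: fin_bigcap_measurable => // p _; apply: measurable_RK_open.
apply: (@open_comp _ _ (fun y => margin D x y p) [set r | 0 < r]) => [y _|].
  exact: margin_continuous.
exact: open_gt.
Qed.

Lemma measurable_safe_closed x : measurable (safe_closed D x).
Proof.
have -> : safe_closed D x =
    \bigcap_(p in [set: 'I_P]) ~` [set y : RK R K0 P | margin D x y p < 0].
  apply/seteqP; split=> y /= h p; first by move=> _ /=; apply/negP; rewrite -leNgt.
  by rewrite leNgt; apply/negP; exact: h.
apply: fin_bigcap_measurable => // p _; apply: measurableC; apply: measurable_RK_open.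
apply: (@open_comp _ _ (fun y => margin D x y p) [set r | r < 0]) => [y _|].
  exact: margin_continuous.
exact: open_lt.
Qed.

Lemma X_DR_open_closed x : X_DR D (safe_open D) x -> X_DR D (safe_closed D) x.
Proof.
move=> [Xx eps_x]; split => //; apply: le_trans eps_x.
apply: ge_ereal_sup => _ [mu mu_ball <-].
apply: (@le_trans _ _ (mu (~` safe_open D x))).
  apply: le_measure; rewrite ?inE.
  - by apply: measurableC; exact: measurable_safe_closed.
  - by apply: measurableC; exact: measurable_safe_open.
  by apply: subsetC => y yo p; exact/ltW/yo.
by apply: ereal_sup_ubound; exists mu.
Qed.

Lemma X_DR_safe (S : 'cV[R]_L -> set (RK R K0 P)) x :
  cc_X D x -> (forall y, S x y) -> X_DR D S x.
Proof.
move=> Xx Sx; split => //; apply: ge_ereal_sup => _ [mu _ <-].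
have -> : S x = setT by apply/seteqP; split.
by rewrite setCT measure0 lee_fin ltW//; case/andP: Hrisk.
Qed.

Lemma kbudget_lt : (kbudget D < N)%N.
Proof.
case/andP: Hrisk => e0 e1; rewrite /kbudget -(ltr_nat R).
apply: (@le_lt_trans _ _ (cc_eps D * N%:R)).
  by rewrite truncn_le// mulr_ge0// ltW.
by rewrite -[ltRHS]mul1r ltr_pM2r// ltr0n.
Qed.

End data.

(** * Robust feasibility certificates *)

Section certificates.
Context {R : realType} {L K0 P N : nat} {D : ccdata R L K0 P N}.
Hypotheses (HP : (0 < P)%N) (HN : (0 < N)%N).
Hypotheses (Hrisk : 0 < cc_eps D < 1) (Hradius : 0 < cc_theta D).
Hypotheses (Hnrm : is_norm (cc_norm D))
  (Hdnrm : is_block_dual_norm (cc_norm D) (cc_dnorm D)).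
Implicit Types (x : 'cV[R]_L) (y : 'M[R]_(K0, P)) (p : 'I_P).

Let w x := cc_b D - (cc_A D)^T *m x.
Let p0 : 'I_P := Ordinal HP.

(** A dual solution [(t, r)] of the worst-case probability problem certifies
robust feasibility.  The hypothesis [w x != 0] serves to make [t] positive, so
that the bound [t * mu(unsafe) <= eps * t] can be divided by [t]. *)
Lemma certificate_X_DR_open x t (r : 'I_N -> R) :
  cc_X D x -> w x != 0 -> (forall i, 0 <= r i) ->
  cc_theta D * cc_dnorm D (w x) + N%:R^-1 * \sum_i r i <= cc_eps D * t ->
  (forall i, t <= r i \/ forall p, t - r i <= margin D x (cc_xi D i) p) ->
  X_DR D (safe_open D) x.
Proof.
move=> Xx w0 r0 budget cover.
have c0 := dual_norm_gt0 Hnrm Hdnrm p0 w0.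
have /andP[e0 e1] := Hrisk.
have t0 : 0 < t.
  rewrite -(pmulr_rgt0 _ e0); apply: lt_le_trans budget.
  by rewrite ltr_wpDr ?mulr_gt0// mulr_ge0 ?invr_ge0// sumr_ge0.
(* This is the positive part of [t] minus the positive part of the least
   margin, written as a maximum over [p]. *)
pose phi y : R := \big[Num.max/0]_(p < P) Num.min t (t - margin D x y p).
have phi0 y : 0 <= phi y by exact: bigmax_ge_id.
have mphi : measurable_fun setT (phi : RK R K0 P -> R).
  apply: measurable_bigmaxr => p; apply: measurable_minr; first exact: measurable_cst.
  by apply: measurable_funB; [exact: measurable_cst|exact: measurable_margin].
split => //; apply: ge_ereal_sup => _ [mu mu_ball <-].
have mU := measurableC (measurable_safe_open (D := D) x).
have reach y y' : (~` safe_open D x) y' ->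
    t <= phi y + cc_dnorm D (w x) * cc_norm D (y - y').
  move=> /existsNP[p /negP]; rewrite -leNgt => y'p.
  have := margin_le Hnrm Hdnrm x y y' p; rewrite -/(w x).
  set e := _ * cc_norm D _ => yy'.
  have e_ge0 : 0 <= e by rewrite mulr_ge0 ?(nrm_ge0 Hnrm)// ltW.
  rewrite -lerBlDr; apply: (@le_trans _ _ (Num.min t (t - margin D x y p))).
    by rewrite le_min gerBl e_ge0 /=; lra.
  exact: (le_bigmax _ (fun p => Num.min t (t - margin D x y p))).
have := transport_bound Hnrm mU (ltW t0) c0 phi0 mphi reach mu_ball.
move=> /le_trans bound; rewrite -(@lee_pmul2l _ t%:E)// -EFinM; apply: bound.
rewrite lee_fin [t * _]mulrC addrC [X in X + _]mulrC; apply: le_trans budget.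
rewrite lerD2l ler_wpM2l ?invr_ge0//; apply: ler_sum => i _.
apply/bigmax_leP; split => // p _; case: (cover i) => [tr|/(_ p) tr].
  by rewrite ge_min tr.
by rewrite ge_min; apply/orP; right; lra.
Qed.

(** If the common margin were negative, every sample would need [r i >= t], and
strictly more for the samples that are kept, which exist because the budget is
below [N]; the mean of [r] would then exceed [t], hence [eps * t], against the
budget row. *)
Lemma certificate_degenerate x t (r : 'I_N -> R) (z : 'I_N -> bool) p :
  w x = 0 ->
  cc_theta D * cc_dnorm D (w x) + N%:R^-1 * \sum_i r i <= cc_eps D * t ->
  0 <= t -> (\sum_i z i <= kbudget D)%N ->
  (forall i, z i -> t <= r i) ->
  (forall i, ~~ z i -> t - r i <= margin D x (cc_xi D i) p) ->
  0 <= cc_d D p - dotv (cc_a D p) x.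
Proof.
move=> w0 + t0 zk removed kept.
rewrite /= w0 (dual_norm0 Hnrm Hdnrm p0) mulr0 add0r => budget.
have /andP[e0 e1] := Hrisk.
rewrite leNgt; apply/negP => mu0.
have [j zj] : exists j, ~~ z j.
  apply/existsP; rewrite -negb_forall; apply/negP => /forallP zT.
  have := leq_ltn_trans zk (kbudget_lt HN Hrisk).
  rewrite (eq_bigr (fun=> 1%N)) => [|i _]; last by rewrite zT.
  by rewrite sum1_card card_ord ltnn.
have lt_r i : ~~ z i -> t < r i.
  by move=> /kept; rewrite margin_degenerate//; lra.
have : t * N%:R < \sum_i r i.
  have -> : t * N%:R = \sum_(i < N) t by rewrite sumr_const card_ord mulr_natr.
  rewrite (bigD1 j)//= [ltRHS](bigD1 j)//= ltr_leD ?lt_r//.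
  apply: ler_sum => i _; case: (boolP (z i)) => [/removed//|zi].
  exact/ltW/lt_r.
apply/negP; rewrite -leNgt; rewrite -ler_pdivrMr ?ltr0n// mulrC.
by apply: le_trans budget _; rewrite ler_piMl// ltW.
Qed.

(** Robust feasibility tested against the finitely supported distributions of
[exists_discrete_transport]: all that necessity extracts from it. *)
Lemma X_DR_closed_transport x (v : 'I_N -> R) (zeta : 'I_N -> 'M[R]_(K0, P)) :
  X_DR D (safe_closed D) x -> (forall i, 0 <= v i <= N%:R^-1) ->
  \sum_i v i * cc_norm D (cc_xi D i - zeta i) <= cc_theta D ->
  (forall i, 0 < v i -> exists p, margin D x (zeta i) p < 0) ->
  \sum_i v i <= cc_eps D.
Proof.
move=> [_ eps_x] v01 cost_le unsafe.
have [nu nu_ball nuU] := exists_discrete_transport Hnrm HN v01 cost_le.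
rewrite -lee_fin; apply: le_trans eps_x.
apply: (@le_trans _ _ (nu (~` safe_closed D x))); last first.
  by apply: ereal_sup_ubound; exists nu.
apply: nuU => i /unsafe[p]; rewrite ltNge => /negP np yc.
by apply: np; exact: yc.
Qed.

(** Converse of [margin_le] up to [e]: moving along a direction that nearly
attains the dual norm reaches a negative margin at nearly optimal cost.  The
slack [e] pays for the strict inequality and for a direction that need not
attain the dual norm exactly. *)
Lemma approach_unsafe x y p e : w x != 0 -> 0 < e ->
  exists2 zeta, margin D x zeta p < 0 &
    cc_dnorm D (w x) * cc_norm D (y - zeta) <= Num.max 0 (margin D x y p) + e.
Proof.
move=> w0 e0; set m := margin D x y p.
have c0 := dual_norm_gt0 Hnrm Hdnrm p0 w0.
case: (ltrP m 0) => m0.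
  exists y => //; rewrite subrr (nrm0 Hnrm) mulr0; lra.
pose s := (m + e) / cc_dnorm D (w x).
have s0 : 0 < s by rewrite divr_gt0//; lra.
have msc : m / s < cc_dnorm D (w x).
  by rewrite ltr_pdivrMr// /s mulrCA mulfV ?gt_eqF// mulr1; lra.
have [u u1 mu] := dual_norm_approx Hnrm Hdnrm p msc.
have diffE : y - (y - s *: u) = s *: u by rewrite opprB addrC subrK.
exists (y - s *: u).
  have := marginB (D := D) x y (y - s *: u) p; rewrite diffE -/(w x).
  have -> : col p (s *: u) = s *: col p u by apply/matrixP => i j; rewrite !mxE.
  by rewrite dotvZr -/m; move: mu; rewrite ltr_pdivrMr// => mu; lra.
rewrite diffE; case: (Hnrm) => _ -> _.
rewrite gtr0_norm// mulrA /s mulrCA mulfV ?gt_eqF// mulr1.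
by rewrite ler_piMr//; lra.
Qed.

End certificates.

(** * From robust feasibility to the knapsack formulation *)

Lemma sum_threshold_weights (R : realType) (I : finType) (S : {set I}) (i0 : I)
    (a b : R) (f : I -> R) : i0 \notin S ->
  \sum_i (if i \in S then a else if i == i0 then b else 0) * f i =
  a * (\sum_(i in S) f i) + b * f i0.
Proof.
move=> i0S; rewrite (bigID (fun i => i \in S))/= mulr_sumr; congr (_ + _).
  by apply: eq_bigr => i ->.
rewrite (bigD1 i0)//= (negbTE i0S) eqxx big1 ?addr0// => i /andP[/negbTE -> /negbTE ->].
by rewrite mul0r.
Qed.

Section reformulation.
Context {R : realType} {L K0 P N : nat} {D : ccdata R L K0 P N}.
Hypotheses (HP : (0 < P)%N) (HN : (0 < N)%N).
Hypotheses (Hrisk : 0 < cc_eps D < 1) (Hradius : 0 < cc_theta D).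
Hypotheses (Hnrm : is_norm (cc_norm D))
  (Hdnrm : is_block_dual_norm (cc_norm D) (cc_dnorm D)).
Implicit Types (x : 'cV[R]_L) (y : 'M[R]_(K0, P)) (p : 'I_P).

Let w x := cc_b D - (cc_A D)^T *m x.
Let p0 : 'I_P := Ordinal HP.

Section closed_feasible.
Hypothesis HM : forall i p x, cc_X D x ->
  `|dotv (rowvec D i p) x + rhs D i p| <= cc_M D i.
Variable x : 'cV[R]_L.
Hypothesis DRx : X_DR D (safe_closed D) x.

Let X_x : cc_X D x. Proof. by case: DRx. Qed.

Let weight0 (b : bool) : 0 <= (b%:R * N%:R^-1 : R) <= N%:R^-1.
Proof. by case: b; rewrite ?mul1r ?mul0r ?lexx invr_ge0 ler0n. Qed.

(** The empirical distribution itself belongs to the ball: the plan below moves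
the unsafe samples onto themselves at no cost. *)
Lemma unsafe_samples_le_kbudget (z : 'I_N -> bool) :
  (forall i, z i -> exists p, margin D x (cc_xi D i) p < 0) ->
  (\sum_i z i <= kbudget D)%N.
Proof.
move=> zU; rewrite /kbudget truncn_ge_nat; last first.
  by case/andP: Hrisk => e0 _; rewrite mulr_ge0// ltW.
rewrite -ler_pdivrMr ?ltr0n// natr_sum mulr_suml.
apply: (X_DR_closed_transport HN Hnrm DRx (zeta := cc_xi D)) => [i||i].
- exact: weight0.
- by rewrite big1 ?ltW// => i _; rewrite subrr (nrm0 Hnrm) mulr0.
- by case: (boolP (z i)) => [/zU//|_]; rewrite mul0r ltxx.
Qed.

Lemma degenerate_margin_ge0 p : w x = 0 -> 0 <= cc_d D p - dotv (cc_a D p) x.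
Proof.
move=> w0; rewrite leNgt; apply/negP => mu0.
have := @unsafe_samples_le_kbudget xpredT.
rewrite sum1_card card_ord leqNgt (kbudget_lt HN Hrisk) => /(_ _)/negP; apply => // i _.
by exists p; rewrite margin_degenerate.
Qed.

(** Strong duality, by exhibiting the optimal dual solution: with the least [r]
allowed, the slack of the budget row is a concave piecewise linear function of
[t], maximal at the [(k+1)]-th smallest [g i].  Violation of the row there yields a primal solution, a
transport of more than [eps] into the unsafe set within the radius. *)
Lemma closed_feasible_knapsack : exists z t r, knapsack D (Decision z t r x).
Proof.
have /andP[e0 e1] := Hrisk.
have HMm i p : `|margin D x (cc_xi D i) p| <= cc_M D i.
  by rewrite -sample_margin; exact: HM.
have [w0|w0] := eqVneq (w x) 0.
  exists (fun=> false), 0, (fun=> 0); split; first by do !split.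
  split => [|i|i p||i p].
  - by rewrite -/(w x) w0 (dual_norm0 Hnrm Hdnrm p0) big1// !mulr0 addr0.
  - rewrite subrr subr0 mulr1; exact: le_trans (HMm i p0).
  - rewrite sample_margin margin_degenerate// subrr mulr0 addr0.
    exact: degenerate_margin_ge0.
  - by rewrite big1.
  - rewrite sample_margin margin_degenerate// mulr0 addr0.
    exact: degenerate_margin_ge0.
have c0 := dual_norm_gt0 Hnrm Hdnrm p0 w0.
set c := cc_dnorm D (w x) in c0.
have /choice[worst worstP] : forall i : 'I_N, exists p : 'I_P,
    forall p', margin D x (cc_xi D i) p <= margin D x (cc_xi D i) p'.
  move=> i.
  case: (arg_minP (fun p => margin D x (cc_xi D i) p) (P := xpredT) (i0 := p0))
    => // p _ h.
  by exists p => p'; exact: h.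
pose m i := margin D x (cc_xi D i) (worst i).
pose g i : R := Num.max 0 (m i).
pose z i := m i < 0.
have g0 i : 0 <= g i by rewrite le_max lexx.
have kN := kbudget_lt HN Hrisk; set k := kbudget D in kN.
have [S [i0 [cS i0S Sle notSge]]] := exists_order_threshold g kN.
pose t := g i0.
pose r i := if i \in S then t - g i else 0.
have tr i : t - r i <= g i.
  by rewrite /r; case: ifPn => [_|/notSge]; rewrite ?subr0// opprB addrC subrK.
exists z, t, r; split; first (split; [exact: g0|split=> [i|//]]).
  by rewrite /r; case: ifP => // iS; rewrite subr_ge0; exact: Sle.
split => [|i|i p||i p].
- rewrite -/(w x) -/c leNgt; apply/negP => lt_theta.
  (* The mass of the threshold sample which completes [k] whole samples to mass
     exactly [eps]. *)
  pose lam := cc_eps D - k%:R / N%:R.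
  have lam0 : 0 <= lam.
    by rewrite subr_ge0 ler_pdivrMr ?ltr0n// truncn_le// mulr_ge0// ltW.
  have lam1 : lam < N%:R^-1.
    rewrite ltrBlDr -{1}[N%:R^-1]mul1r -mulrDl ltr_pdivlMr ?ltr0n//.
    by rewrite nat1r truncnS_gt.
  have r_sum : \sum_i r i = k%:R * t - \sum_(i in S) g i.
    by rewrite -big_mkcond/= sumrB sumr_const cS mulr_natl.
  have N1 : N%:R^-1 <= 1 :> R by rewrite invf_le1 ?ler1n ?ltr0n.
  have kN1 : k%:R / N%:R <= 1 :> R by rewrite ler_pdivrMr ?mul1r ?ler_nat ?ltr0n// ltnW.
  set G := \sum_(i in S) g i in r_sum.
  pose gap := cc_theta D * c - (N%:R^-1 * G + lam * t).
  have gap0 : 0 < gap.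
    move: lt_theta; rewrite r_sum /gap /lam -subr_gt0.
    by congr (0 < _); ring.
  (* The extra mass and the extra distance are both [e]: the cost then grows by
     at most [e * (k / N + lam + t + e) <= e * (3 + t)]. *)
  pose e := Num.min (N%:R^-1 - lam) (Num.min 1 (gap / (3 + t))).
  have t0 : 0 <= t by exact: g0.
  have e_gt0 : 0 < e.
    by rewrite !lt_min subr_gt0 lam1 ltr01 divr_gt0//; lra.
  have [e_le1 e_le_gap e_le_mass] : [/\ e <= 1, e * (3 + t) <= gap & e <= N%:R^-1 - lam].
    rewrite -ler_pdivlMr; last lra.
    by rewrite !ge_min !lexx ?orbT.
  have /choice[zeta zetaP] : forall i : 'I_N, exists y,
      margin D x y (worst i) < 0 /\
      c * cc_norm D (cc_xi D i - y) <= g i + e.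
    move=> i; have [y yU yn] :=
      approach_unsafe HP Hnrm Hdnrm (cc_xi D i) (worst i) w0 e_gt0.
    by exists y.
  pose v i := if i \in S then N%:R^-1 else if i == i0 then lam + e else 0.
  have v01 i : 0 <= v i <= N%:R^-1.
    rewrite /v; case: ifP => _; first by rewrite lexx invr_ge0 ler0n.
    by case: ifP => _; rewrite ?lexx ?invr_ge0 ?ler0n//; lra.
  suff : \sum_i v i <= cc_eps D.
    have -> : \sum_i v i = \sum_i v i * 1 by under [RHS]eq_bigr do rewrite mulr1.
    by rewrite sum_threshold_weights// sumr_const cS /lam mulrC; lra.
  apply: (X_DR_closed_transport HN Hnrm DRx v01 (zeta := zeta)); last first.
    by move=> i _; exists (worst i); case: (zetaP i).
  rewrite -(ler_pM2r c0) mulr_suml.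
  apply: (@le_trans _ _ (\sum_i v i * (g i + e))).
    apply: ler_sum => i _; rewrite -mulrA ler_wpM2l//; first by case/andP: (v01 i).
    by rewrite mulrC; case: (zetaP i).
  rewrite sum_threshold_weights// big_split/= sumr_const cS -/G -/t -mulr_natl.
  have -> : cc_theta D * c = gap + (N%:R^-1 * G + lam * t) by rewrite /gap subrK.
  suff : k%:R / N%:R * e + lam * e + e * t + e * e <= gap by lra.
  apply: le_trans e_le_gap.
  have h1 : k%:R / N%:R * e <= e by rewrite ler_piMl// ltW.
  have h2 : lam * e <= e by rewrite ler_piMl ?ltW//; lra.
  have h3 : e * e <= e by rewrite ler_piMl// ltW.
  lra.
- have := tr i; rewrite /g /z; case: ltrP => m0.
    by rewrite subrr mulr0.
  rewrite subr0 mulr1 => /le_trans; apply; apply: le_trans (HMm i (worst i)).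
  exact: ler_norm.
- have := tr i; rewrite sample_margin /g /z; case: ltrP => m0 /le_trans; apply.
    by rewrite mulr1; have := HMm i p; rewrite ler_norml; lra.
  by rewrite mulr0 addr0; exact: worstP.
- by apply: unsafe_samples_le_kbudget => i zi; exists (worst i).
- rewrite sample_margin /z; case: ltrP => m0.
    by rewrite mulr1; have := HMm i p; rewrite ler_norml; lra.
  by rewrite mulr0 addr0; apply: le_trans m0 _; exact: worstP.
Qed.

End closed_feasible.
End reformulation.

(** * The improved formulation *)

Section improved_formulation.
Context {R : realType} {L K0 P N : nat} {D : ccdata R L K0 P N}.
Variable q : 'I_N -> 'I_P -> R.
Hypotheses (HP : (0 < P)%N) (HN : (0 < N)%N).
Hypotheses (Hrisk : 0 < cc_eps D < 1) (Hradius : 0 < cc_theta D).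
Hypotheses (Hnrm : is_norm (cc_norm D))
  (Hdnrm : is_block_dual_norm (cc_norm D) (cc_dnorm D)).

Lemma improved_removed (s : decision R L N) i :
  improved D q s -> dz s i -> dt s <= dr s i.
Proof.
case: s => z t r x [_ [_ big_M _ _ _]] /= zi.
by have := big_M i; rewrite zi subrr mulr0 subr_le0.
Qed.

Lemma improved_kept (s : decision R L N) i p :
  improved D q s -> ~~ dz s i -> dt s - dr s i <= margin D (dx s) (cc_xi D i) p.
Proof.
case: s => z t r x [_ [_ _ _ _ kept]] /= /negbTE zi.
by have := kept i p; rewrite zi mulr0 addr0 sample_margin.
Qed.

Lemma improved_X_DR_open_nondegenerate (s : decision R L N) :
  improved D q s -> cc_b D - (cc_A D)^T *m dx s != 0 ->
  X_DR D (safe_open D) (dx s).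
Proof.
move=> imp w0; have removed := improved_removed imp.
have kept i p (zi : ~~ dz s i) := improved_kept p imp zi.
case: s imp w0 removed kept => z t r x [[_ [r0 Xx]] [budget _ _ _ _]] /= w0 removed kept.
apply: (certificate_X_DR_open HP Hrisk Hradius Hnrm Hdnrm Xx w0 r0 budget) => i.
by case: (boolP (z i)) => zi; [left; exact: removed|right=> p; exact: kept].
Qed.

(** Here [b = A^T x], so the value bounded is the margin of every scenario. *)
Lemma improved_degenerate (s : decision R L N) p :
  improved D q s -> cc_b D - (cc_A D)^T *m dx s = 0 ->
  0 <= cc_d D p - dotv (cc_a D p) (dx s).
Proof.
move=> imp w0; have removed := improved_removed imp.
have kept i p (zi : ~~ dz s i) := improved_kept p imp zi.
case: s imp w0 removed kept => z t r x [[t0 _] [budget _ zk _ _]] /= w0 removed kept.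
apply: (certificate_degenerate HP HN Hrisk Hnrm Hdnrm w0 budget t0 zk) => // i.
by move=> zi; exact: kept.
Qed.

Lemma improved_X_DR_closed (s : decision R L N) :
  improved D q s -> X_DR D (safe_closed D) (dx s).
Proof.
move=> imp; have [w0|w0] := eqVneq (cc_b D - (cc_A D)^T *m dx s) 0; last first.
  exact/X_DR_open_closed/improved_X_DR_open_nondegenerate.
apply: X_DR_safe => //; first by case: s imp {w0} => z t r x [[_ []]].
by move=> y p; rewrite margin_degenerate//; exact: improved_degenerate.
Qed.

Lemma improved_X_DR_open (s : decision R L N) :
  improved D q s ->
  cc_b D <> (cc_A D)^T *m dx s \/ (forall p, cc_d D p <> dotv (cc_a D p) (dx s)) ->
  X_DR D (safe_open D) (dx s).
Proof.
move=> imp side; have [w0|w0] := eqVneq (cc_b D - (cc_A D)^T *m dx s) 0; last first.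
  exact: improved_X_DR_open_nondegenerate.
case: side => [[]|d_neq]; first exact/subr0_eq.
apply: X_DR_safe => //; first by case: s imp {w0 d_neq} => z t r x [[_ []]].
move=> y p; rewrite margin_degenerate// lt_neqAle improved_degenerate// andbT.
by rewrite eq_sym subr_eq0; exact/eqP.
Qed.

(** The strengthened row for [z i = 1] reads [t - r i <= u.x - q], whose right
side is nonnegative by the quantile row, while the big-M row already forces
[t - r i <= 0]. *)
Lemma knapsack_improved (Xbar : set 'cV[R]_L) (s : decision R L N) :
  (forall i p, quantile D Xbar i p = (q i p)%:E) ->
  knapsack D s -> Xbar (dx s) -> improved D q s.
Proof.
move=> Hq; case: s => z t r x [dom [budget big_M cover zk valid]] /= Xbarx.
have q_le i p : q i p <= dotv (rowvec D i p) x.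
  rewrite -lee_fin -Hq; apply: (nth_sort_le_but_few _ (kbudget_lt HN Hrisk) zk).
  move=> j /negbTE zj; apply: ereal_inf_lbound; exists x => //; split=> // g.
  by have := valid j g; rewrite zj mulr0 addr0.
split => //; split => // i p.
case: (boolP (z i)) => zi; last first.
  by have := cover i p; rewrite (negbTE zi) !mulr0.
have := big_M i; rewrite zi subrr mulr0 mulr1 => tr; apply: le_trans tr _.
by have := q_le i p; lra.
Qed.

End improved_formulation.

Theorem theorem2 (R : realType) (L K0 P N : nat) (D : ccdata R L K0 P N)
    (Xbar : set 'cV[R]_L) (q : 'I_N -> 'I_P -> R)
    (HK0 : (0 < K0)%N) (HP : (0 < P)%N) (HN : (0 < N)%N)
    (Hrisk : 0 < cc_eps D < 1) (Hradius : 0 < cc_theta D)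
    (Hnrm : is_norm (cc_norm D))
    (Hdnrm : is_block_dual_norm (cc_norm D) (cc_dnorm D))
    (HM0 : forall i, 0 < cc_M D i)
    (HM : forall i p x, cc_X D x ->
      `|dotv (rowvec D i p) x + rhs D i p| <= cc_M D i)
    (HXbar : exists s, minimizer (obj D) (knapsack D) s /\ Xbar (dx s))
    (Hq : forall i p, quantile D Xbar i p = (q i p)%:E) :
  (exists s x, [/\ minimizer (obj D) (improved D q) s,
      minimizer (objx D) (X_DR D (safe_closed D)) x & obj D s = objx D x]) /\
  (forall s, minimizer (obj D) (improved D q) s ->
    minimizer (objx D) (X_DR D (safe_closed D)) (dx s)) /\
  (forall s, minimizer (obj D) (improved D q) s ->
    cc_b D <> (cc_A D)^T *m dx s \/
      (forall p, cc_d D p <> dotv (cc_a D p) (dx s)) ->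
    minimizer (objx D) (X_DR D (safe_open D)) (dx s)).
Proof.
case: HXbar => s0 [[knap_s0 min_s0] Xbar_s0].
have imp_s0 : improved D q s0 by exact: (knapsack_improved HN Hrisk Hq).
have imp_closed s : improved D q s -> X_DR D (safe_closed D) (dx s).
  exact: improved_X_DR_closed.
have s0_le x : X_DR D (safe_closed D) x -> obj D s0 <= objx D x.
  move=> /(closed_feasible_knapsack HP HN Hrisk Hradius Hnrm Hdnrm HM)[z [t [r]]].
  exact: min_s0.
have min_closed s : minimizer (obj D) (improved D q) s ->
    minimizer (objx D) (X_DR D (safe_closed D)) (dx s).
  move=> [imp_s min_s]; split=> [|x /s0_le]; first exact: imp_closed.
  exact/le_trans/min_s.
have min_imp_s0 : minimizer (obj D) (improved D q) s0.
  by split=> // s /imp_closed/s0_le.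
split; first by exists s0, (dx s0); split=> //; exact: min_closed.
split=> // s min_s side; have [_ opt_s] := min_closed _ min_s.
split=> [|x /X_DR_open_closed/opt_s//].
by case: min_s => imp_s _; apply: improved_X_DR_open imp_s side.
Qed.
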